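(* Let $d>3$ be an integer, $0<L\le U$, $\gamma\in\mathbb{R}$, $\alpha_{\uparrow}>1$, $0<\alpha_{\downarrow}<1$. Let $h\in\mathcal{P}^{\gamma}_{d,L,U}$ with unique global minimum $x^{\mathrm{opt}}$, and let $\{(\tilde\theta_t,\mathcal{F}_t)\}_{t\ge0}=\mathtt{ES}(h,\tilde\theta_0,\{z_t\}_{t\ge0})$, $\tilde\theta_t=(\tilde m_t,\log\tilde\sigma_t)$, with $\tilde m_0\ne x^{\mathrm{opt}}$. Then $$\Pr\left[\liminf_{t\to\infty}\frac1t\log\left(\frac{\|\tilde m_t-x^{\mathrm{opt}}\|}{\|\tilde m_0-x^{\mathrm{opt}}\|}\right)\ge-\frac1d\right]=1;$$ that is, the lower convergence rate $\exp(-\mathrm{CR}^{\mathrm{lower}})$ on $h$ satisfies $\exp(-\mathrm{CR}^{\mathrm{lower}})\ge\exp(-1/d)$.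
   Context: **Algorithm.** A state is $\theta=(m,\log\sigma)\in\Theta=\mathbb{R}^{d+1}$ with $m\in\mathbb{R}^d$, $\sigma>0$. Let $\{z_t\}_{t\ge0}$ be independent $\mathcal{N}(0,I)$ vectors in $\mathbb{R}^d$. For measurable $f:\mathbb{R}^d\to\mathbb{R}$ and $\theta_0\in\Theta$, $\{(\theta_t,\mathcal{F}_t)\}_{t\ge0}=\mathtt{ES}(f,\theta_0,\{z_t\})$ denotes the process $\theta_{t+1}=\theta_t+\mathcal{G}(\theta_t,z_t;f)$ with its natural filtration, where $\mathcal{G}(\theta,z;f)=(\sigma z,\log\alpha_{\uparrow})\mathbb{1}\{f(m+\sigma z)\le f(m)\}+(0,\log\alpha_{\downarrow})\mathbb{1}\{f(m+\sigma z)>f(m)\}$. **Lower convergence rate.** $\exp(-\mathrm{CR}^{\mathrm{lower}})$, where $\mathrm{CR}^{\mathrm{lower}}$ is the constant with $\liminf_{t\to\infty}\frac1t\log(\|\tilde m_t-x^{\mathrm{opt}}\|/\|\tilde m_0-x^{\mathrm{opt}}\|)=-\mathrm{CR}^{\mathrm{lower}}$ with probability one. **Function classes.** $\Theta_0=\{\theta\in\Theta:m\neq0\}$. $\mathcal{S}_{d,L,U}$ is the set of $f:\mathbb{R}^d\to\mathbb{R}$ such that: (A1) $f$ is measurable, continuously differentiable, $L$-strongly convex and $U$-Lipschitz smooth on $\mathbb{R}^d$, i.e. $f(x)+\langle y-x,\nabla f(x)\rangle+\frac L2\|x-y\|^2\le f(y)\le f(x)+\langle y-x,\nabla f(x)\rangle+\frac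 U2\|x-y\|^2$ for all $x,y$, and its unique global minimum is at the origin with $f(0)=0$; (A2) with $z\sim\mathcal{N}(0,I)$, $\mathcal{Q}_z(\theta)=\frac{2}{\sigma^2}(f(m+\sigma z)-f(m)-\langle\nabla f(m),\sigma z\rangle)$, $z_e=\langle z,\nabla f(m)\rangle/\|\nabla f(m)\|$, $\mathcal{V}_{\mathrm{std}}(\theta)=\mathrm{Var}[\mathcal{Q}_z(\theta)]/(\mathbb{E}[\mathcal{Q}_z(\theta)])^2$, and $\kappa_{\inf}=\inf_{\theta\in\Theta_0}\mathbb{E}[\mathcal{Q}_z(\theta)]/\mathbb{E}[\mathcal{Q}_z(\theta)\mathbb{1}\{z_e\le0\}]$, one has $\sup_{\theta\in\Theta_0}\mathcal{V}_{\mathrm{std}}(\theta)<\frac14\min\{\Phi(\frac{\kappa_{\inf}}2\cdot\frac1{\sqrt{2\pi}})-\frac12,\ 1-\Phi(\frac{\kappa_{\inf}}2\cdot\frac3{\sqrt{2\pi}})\}$, where $\Phi$ is the standard normal cdf. $\mathcal{T}^{\gamma}(f)$ is the set of (measurable) $h:\mathbb{R}^d\to\mathbb{R}$ with a unique global minimum $x^{\mathrm{opt}}$ for which there is a strictly increasing $g:\mathbb{R}\to\mathbb{R}$ with $h(x)=g(f(x-x^{\mathrm{opt}}))$ for all $x$ with $h(x)\le\gamma$. $\mathcal{P}^{\gamma}_{d,L,U}=\bigcup_{f\in\mathcal{S}_{d,L,U}}\mathcal{T}^{\gamma}(f)$. *)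

(* Defs.v *)
From HB Require Import structures.
From mathcomp Require Import all_boot all_order all_algebra.
From mathcomp Require Import all_classical all_reals all_analysis.

Set Implicit Arguments.
Unset Strict Implicit.
Unset Printing Implicit Defensive.

Import Order.TTheory GRing.Theory Num.Theory.
Import numFieldNormedType.Exports.

Local Open Scope classical_set_scope.
Local Open Scope ring_scope.

(* Row vectors carry the product sigma-algebra (the one generated by the
   coordinates), as n.-tuple T does in the library; for T = R this is the
   Borel sigma-algebra of R^n. *)
Definition measure_rV_display : measure_display -> measure_display.
Proof. exact. Qed.

Section measurable_rV.
Context {d : measure_display} {T : measurableType d} (n : nat).

Let coors : 'I_n -> 'rV[T]_n -> T := fun i x => x ord0 i.

Let rV_set0 : g_sigma_preimage coors set0.
Proof. exact: sigma_algebra0. Qed.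

Let rV_setC A : g_sigma_preimage coors A -> g_sigma_preimage coors (~` A).
Proof. exact: sigma_algebraC. Qed.

Let rV_bigcup (F : _^nat) : (forall i, g_sigma_preimage coors (F i)) ->
  g_sigma_preimage coors (\bigcup_i (F i)).
Proof. exact: sigma_algebra_bigcup. Qed.

HB.instance Definition _ := @isMeasurable.Build (measure_rV_display d)
  'rV[T]_n (g_sigma_preimage coors) rV_set0 rV_setC rV_bigcup.

End measurable_rV.

Lemma measurable_coord (d : measure_display) (T : measurableType d) (n : nat)
    (i : 'I_n) :
  measurable_fun [set: 'rV[T]_n] (fun x : 'rV[T]_n => x ord0 i).
Proof.
move=> _ Y mY; rewrite setTI; apply: sub_sigma_algebra => /=.
rewrite -bigcup_seq/=; exists i => /=; first by rewrite mem_index_enum.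
by exists Y => //; rewrite setTI.
Qed.

Lemma measurable_fun_rVP (d1 d2 : measure_display) (T1 : measurableType d1)
    (T2 : measurableType d2) (n : nat) (f : T1 -> 'rV[T2]_n) :
  measurable_fun [set: T1] f <->
  forall i, measurable_fun [set: T1] (fun x => f x ord0 i).
Proof.
split=> [mf i|mf].
  exact: (measurableT_comp (measurable_coord i) mf).
move=> _ A mA; rewrite setTI.
suff : preimage_set_system setT f
    (g_sigma_preimage (fun i (x : 'rV[T2]_n) => x ord0 i)) `<=` measurable.
  by apply; exists A => //; rewrite setTI.
rewrite -g_sigma_preimage_comp.
apply: smallest_sub; first exact: sigma_algebra_measurable.
move=> B; rewrite -bigcup_seq => -[i _ [C mC <-]].
exact: mf.
Qed.

Section standard_normal.
Context {R : realType}.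

Definition rV_cons (n : nat) (x : measurableTypeR R * 'rV[R]_n) : 'rV[R]_n.+1 :=
  row_mx x.1%:M x.2.

Lemma rV_cons0 (n : nat) x : rV_cons x ord0 (ord0 : 'I_n.+1) = x.1.
Proof.
have -> : ord0 = lshift n (ord0 : 'I_1) :> 'I_(1 + n) by exact/val_inj.
by rewrite /rV_cons [LHS]row_mxEl mxE mulr1n.
Qed.

Lemma rV_consS (n : nat) x (i : 'I_n) :
  rV_cons x ord0 (lift ord0 i) = x.2 ord0 i.
Proof.
have -> : lift ord0 i = rshift 1 i :> 'I_(1 + n) by exact/val_inj.
by rewrite /rV_cons [LHS]row_mxEr.
Qed.

Lemma measurable_rV_cons (n : nat) : measurable_fun setT (@rV_cons n).
Proof.
apply/measurable_fun_rVP => i; case: (unliftP ord0 i) => [j|] ->.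
  under eq_fun do rewrite rV_consS.
  exact: measurableT_comp (measurable_coord j) measurable_snd.
under eq_fun do rewrite rV_cons0.
exact: measurable_fst.
Qed.

HB.instance Definition _ (n : nat) :=
  isMeasurableFun.Build _ _ _ _ (@rV_cons n) (@measurable_rV_cons n).

(* N(0, I) on R^n, as the n-fold product of N(0, 1). *)
Fixpoint std_normal (n : nat) : probability 'rV[R]_n R :=
  match n return probability 'rV[R]_n R with
  | 0 => \d_(0 : 'rV[R]_0)
  | n.+1 => distribution (normal_prob (0 : R) 1 \x std_normal n)%E (@rV_cons n)
  end.

(* The cumulative distribution function of N(0, 1). *)
Definition Phi (x : R) : R := fine (normal_prob (0 : R) 1 `]-oo, x]).

End standard_normal.

Lemma std_normal_box (R : realType) (n : nat) (A : 'I_n -> set R) :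
  (forall i, measurable (A i)) ->
  std_normal n [set v : 'rV[R]_n | forall i, A i (v ord0 i)] =
  (\prod_(i < n) normal_prob (0 : R) 1 (A i))%E.
Proof.
elim: n A => [|n ih] A mA.
  by rewrite big_ord0 /= diracE mem_set//= => -[].
rewrite /= /distribution /pushforward.
rewrite (_ : _ @^-1` _ =
    A ord0 `*` [set v : 'rV[R]_n | forall i, A (lift ord0 i) (v ord0 i)]).
  rewrite product_measure1E//; last first.
    rewrite (_ : [set _ | _] = \bigcap_(i in [set: 'I_n])
      ((fun v : 'rV[R]_n => v ord0 i) @^-1` A (lift ord0 i))).
      apply: fin_bigcap_measurable => // i _.
      by rewrite -[X in measurable X]setTI; exact: measurable_coord.
    by apply/seteqP; split=> v h i; [move=> _; exact: h|exact: (h i I)].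
    exact: mA.
  rewrite big_ord_recl/=; congr (_ * _)%E.
  by apply: (ih (A \o lift ord0)) => i; exact: mA.
apply/seteqP; split => -[x v] /=.
- move=> h; split; first by have := h ord0; rewrite rV_cons0.
  by move=> i /=; have := h (lift ord0 i); rewrite rV_consS.
- move=> [h0 h] i; case: (unliftP ord0 i) => [j|] ->.
  + by rewrite rV_consS; exact: h.
  + by rewrite rV_cons0.
Qed.

Section independence.
Context {disp disp' : measure_display} {T : measurableType disp}
  {U : measurableType disp'} {R : realType} (P : probability T R).

Definition mutually_independent (I : choiceType) (X : I -> {RV P >-> U}) :=
  forall (s : seq I) (B : I -> set U), uniq s ->
    (forall i, measurable (B i)) ->
    P (\bigcap_(i in [set` s]) (X i @^-1` B i)) =
    (\prod_(i <- s) P (X i @^-1` B i))%E.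

Definition has_law (X : {RV P >-> U}) (mu : probability U R) :=
  forall B, measurable B -> distribution P X B = mu B.

End independence.

Section euclidean.
Context {R : realType} {d : nat}.
Implicit Types x y : 'rV[R]_d.

Definition dot x y : R := \sum_(i < d) x ord0 i * y ord0 i.

(* The library norm `|x| on row vectors is the sup norm. *)
Definition enorm x : R := Num.sqrt (dot x x).

Definition grad (f : 'rV[R]_d -> R) x : 'rV[R]_d :=
  \row_(i < d) 'D_('e_i) f x.

Definition continuously_differentiable (f : 'rV[R]_d -> R) :=
  (forall x, differentiable f x) /\ continuous (grad f).

Definition unique_global_min (h : 'rV[R]_d -> R) x :=
  (forall y, h x <= h y) /\
  (forall x', (forall y, h x' <= h y) -> x' = x).

End euclidean.

Section evolution_strategy.
Context {R : realType} {d : nat}.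

(* The pair (m, log sigma). *)
Definition state := ('rV[R]_d * R)%type.

Definition mean (theta : state) : 'rV[R]_d := theta.1.
Definition stepsize (theta : state) : R := expR theta.2.

Variables alpha_up alpha_down : R.

Definition ES_step (theta : state) (z : 'rV[R]_d) (f : 'rV[R]_d -> R) : state :=
  let m := mean theta in
  let sigma := stepsize theta in
  if f (m + sigma *: z) <= f m then (sigma *: z, ln alpha_up)
  else (0, ln alpha_down).

Fixpoint ES (f : 'rV[R]_d -> R) (theta0 : state) (z : nat -> 'rV[R]_d)
    (t : nat) : state :=
  match t with
  | 0 => theta0
  | t.+1 => let theta := ES f theta0 z t in theta + ES_step theta (z t) f
  end.

End evolution_strategy.
Arguments state : clear implicits.

Section function_classes.
Context {R : realType} {d : nat}.

Local Notation gauss := (std_normal d : probability 'rV[R]_d R).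

Definition Theta0 : set (state R d) := [set theta | mean theta != 0].

Definition Qz (f : 'rV[R]_d -> R) (theta : state R d) (z : 'rV[R]_d) : R :=
  let m := mean theta in
  let sigma := stepsize theta in
  2 / sigma ^+ 2 * (f (m + sigma *: z) - f m - dot (grad f m) (sigma *: z)).

Definition ze (f : 'rV[R]_d -> R) (theta : state R d) (z : 'rV[R]_d) : R :=
  dot z (grad f (mean theta)) / enorm (grad f (mean theta)).

Definition Vstd (f : 'rV[R]_d -> R) (theta : state R d) : \bar R :=
  ('V_gauss[Qz f theta] / ('E_gauss[Qz f theta]) ^+ 2)%E.

Definition kappa_inf (f : 'rV[R]_d -> R) : \bar R :=
  ereal_inf [set ('E_gauss[Qz f theta] /
    'E_gauss[fun z => (Qz f theta z *
                       \1_[set z' | (ze f theta z' <= 0)%R] z)%R])%E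
    | theta in Theta0].

Definition S_A1 (L U : R) (f : 'rV[R]_d -> R) :=
  [/\ measurable_fun setT f,
      continuously_differentiable f,
      (forall x y,
         f x + dot (y - x) (grad f x) + L / 2 * enorm (x - y) ^+ 2 <= f y /\
         f y <= f x + dot (y - x) (grad f x) + U / 2 * enorm (x - y) ^+ 2),
      unique_global_min f 0
    & f 0 = 0].

(* Under S_A1 with 0 < L and 0 < d, kappa_inf f is a finite positive number. *)
Definition S_A2 (f : 'rV[R]_d -> R) :=
  let kappa := fine (kappa_inf f) in
  let s := Num.sqrt (2 * pi) in
  (ereal_sup [set Vstd f theta | theta in Theta0] <
   (1 / 4 * Num.min (Phi (kappa / 2 * (1 / s)) - 1 / 2)
                    (1 - Phi (kappa / 2 * (3 / s))))%R%:E)%E.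

Definition Sclass (L U : R) : set ('rV[R]_d -> R) :=
  [set f | S_A1 L U f /\ S_A2 f].

Definition Tclass (gamma : R) (f : 'rV[R]_d -> R) : set ('rV[R]_d -> R) :=
  [set h | measurable_fun setT h /\
    exists xopt, unique_global_min h xopt /\
      exists g : R -> R, {homo g : x y / x < y} /\
        forall x, h x <= gamma -> h x = g (f (x - xopt))].

Definition Pclass (gamma L U : R) : set ('rV[R]_d -> R) :=
  \bigcup_(f in Sclass L U) Tclass gamma f.

End function_classes.

Section convergence_rate.
Context {R : realType} {d : nat}.

(* lne is used so that the logarithm of 0 is -oo. *)
Definition log_rate (theta : nat -> state R d) (xopt : 'rV[R]_d) (t : nat) :
    \bar R :=
  ((t%:R^-1)%:E * lne (enorm (mean (theta t) - xopt) /
                       enorm (mean (theta 0%N) - xopt))%:E)%E.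

Definition is_CR_lower (disp : measure_display) (T : measurableType disp)
    (P : probability T R) (theta : nat -> T -> state R d) (xopt : 'rV[R]_d)
    (CR : \bar R) :=
  P [set w | limn_einf (log_rate (theta ^~ w) xopt) = (- CR)%E] = 1%E.

End convergence_rate.

(* Main.v *)
Require Import Defs.
From HB Require Import structures.
From mathcomp Require Import all_boot all_order all_algebra.
From mathcomp Require Import all_classical all_reals all_analysis.
From mathcomp Require Import measurable_realfun zify ring lra.

Set Implicit Arguments.
Unset Strict Implicit.
Unset Printing Implicit Defensive.

Import Order.TTheory GRing.Theory Num.Theory.
Import numFieldNormedType.Exports.

Local Open Scope classical_set_scope.
Local Open Scope ring_scope.

(** The distance to a fixed point x cannot shrink faster than exp(-t/d), even if
each step could choose its step size freely and keep whichever of m and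
m + sigma z lies closer to x.

The source of this is harmonic analysis. Take x = 0. In dimension d the function
|y|^(-2k) is superharmonic as long as 2k <= d - 2, hence
E |m + sigma z|^(-2k) <= |m|^(-2k) for Gaussian z ([riesz_superharmonic]).
The proof writes |y|^(-2k), up to the factor (k-1)!, as the mixture of Gaussian
kernels  int_0^oo l^(k-1) exp(-l |y|^2) dl: each kernel has an explicit
Gaussian average ([integral_std_normal_expR]), and under the substitution
l / (1 + 2 sigma^2 l) the averaged mixture is bounded by the original mixture
truncated at a finite upper end ([integral_compressed_le]).

Write W = (|m| / |m + sigma z|)^(2k), so that E W <= 1. A single step multiplies
|m|^(-2k/5) by at most max(1, W^(1/5)), and the line through (0, 1) tangent
to the concave function W^(1/5) has slope c = (4/5)^4 / 5, whence
max(1, W^(1/5)) <= 1 + c W. Thus the expectation of the potential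
|m_t|^(-2k/5) grows at most like (1 + c)^t ([expected_potential_le]); this
step uses that the state at time t is independent of z_t.

For d > 3 the choice k = d/2 - 1 (integer division) satisfies both 2k <= d - 2
and 5k >= d. The second inequality makes exp(2k/(5d)) >= exp(2/25) > 1 + c, so
the potentials multiplied by exp(-2kt/(5d)) have summable expectations. Almost
surely they are therefore bounded in t ([ae_bounded_of_geometric_integrals]),
that is log |m_t| >= -t/d - O(1) ([log_rate_ge]). The exponent 1/5 is what
allows d = 5, where k = 1 and exp(2k a/d) > 1 + a (1 - a)^(1/a - 1) requires the
fractional power a to be small. *)

(** * Gamma integrals *)

Section laplace.
Context {R : realType}.
Implicit Types (A b x r : R) (n k : nat).

(** At index n.+1 this is the primitive of x^n exp(-A x) that vanishes at
infinity, given by the integration-by-parts recursion. *)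
Fixpoint gamma_prim A n x : R :=
  if n is k.+1 then (k%:R * gamma_prim A k x - x ^+ k * expR (- A * x)) / A
  else 0.

Lemma gamma_prim_le0 A n x : 0 < A -> 0 <= x -> gamma_prim A n x <= 0.
Proof.
move=> A0 x0; elim: n => //= n ih; rewrite pmulr_lle0 ?invr_gt0// subr_le0.
apply: (@le_trans _ _ 0); first by rewrite mulr_ge0_le0.
by rewrite mulr_ge0 ?exprn_ge0 ?expR_ge0.
Qed.

Lemma gamma_prim0 A n : 0 < A -> gamma_prim A n.+1 0 = - (n`!%:R / A ^+ n.+1).
Proof.
move=> A0; elim: n => [|n ih].
  by rewrite /= mul0r add0r expr0 mul1r mulr0 expR0 expr1 mulNr.
rewrite [LHS]/= -/(gamma_prim A n.+1 0) ih expr0n mul0r subr0 mulrN mulNr.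
by rewrite factS natrM mulrA -mulrA -invfM -exprSr.
Qed.

Lemma is_derive_gamma_prim A n x : 0 < A ->
  is_derive x 1 (gamma_prim A n.+1) (x ^+ n * expR (- A * x)).
Proof.
move=> A0; have An0 : A != 0 by rewrite gt_eqF.
elim: n x => [|n ih] x.
  have -> : gamma_prim A 1 = (fun y => - A^-1 * expR (- A * y)).
    by apply/funext => y /=; rewrite mul0r sub0r expr0 mul1r mulrC mulrN [RHS]mulNr.
  apply: is_derive_eq; rewrite /GRing.scale/= expr0; field.
  exact: An0.
have -> : gamma_prim A n.+2 =
   (fun y => A^-1 * (n.+1%:R * gamma_prim A n.+1 y - y ^+ n.+1 * expR (- A * y))).
  by apply/funext => y; rewrite mulrC.
have {}ih := ih x.
move: (gamma_prim A n.+1) ih => G ih.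
have dX : is_derive x 1 (fun y : R => y ^+ n.+1) (n.+1%:R * x ^+ n).
  have := @is_deriveX R R id n.+1 x 1 1 (is_derive_id _ _).
  by rewrite fctE /GRing.scale/= mulr1.
apply: is_derive_eq; rewrite /GRing.scale/=.
field.
exact: An0.
Qed.

Lemma continuous_gamma_prim A n : 0 < A -> continuous (gamma_prim A n.+1).
Proof.
move=> A0 x; apply: differentiable_continuous.
by apply/derivable1_diffP; have /@ex_derive := is_derive_gamma_prim n x A0.
Qed.

Lemma cvg_expXn_expRN A n : 0 < A -> (x ^+ n * expR (- A * x)) @[x --> +oo] --> 0.
Proof.
move=> A0; pose C : R := n.+1`!%:R / A ^+ n.+1.
have C0 : 0 < C by rewrite divr_gt0 ?exprn_gt0// ltr0n fact_gt0.
apply/cvgrPdist_le => e e0; near=> x.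
have x0 : 0 < x by near: x; exact: nbhs_pinfty_gt.
have Ax0 : 0 < A * x by rewrite mulr_gt0.
rewrite sub0r normrN ger0_norm ?mulr_ge0 ?exprn_ge0 ?expR_ge0 ?(ltW x0)//.
have : (A * x) ^+ n.+1 / n.+1`!%:R <= expR (A * x).
  by apply: le_trans (expR_ge1Dxn n (ltW Ax0)); rewrite lerDr.
rewrite ler_pdivrMr ?ltr0n ?fact_gt0// => h.
rewrite mulNr expRN.
rewrite ler_pdivrMr ?expR_gt0//.
have xC : C / e <= x by near: x; apply: nbhs_pinfty_ge; exact: num_real.
have {}h : x ^+ n.+1 <= C * expR (A * x).
  rewrite /C mulrAC ler_pdivlMr ?exprn_gt0// mulrC -exprMn.
  by rewrite (mulrC _%:R).
rewrite -(ler_pM2r x0) -exprSr (le_trans h)// [leRHS]mulrAC ler_pM2r ?expR_gt0//.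
by rewrite mulrC -ler_pdivrMr.
Unshelve. all: by end_near. Qed.

Lemma cvg_gamma_prim A n : 0 < A -> gamma_prim A n x @[x --> +oo] --> 0.
Proof.
move=> A0; elim: n => [|n ih] /=; first exact: cvg_cst.
rewrite [X in _ --> X](_ : _ = (n%:R * 0 - 0) / A); last first.
  by rewrite mulr0 subr0 mul0r.
apply: cvgMl; apply: cvgB; last exact: cvg_expXn_expRN.
exact: cvgMr.
Qed.

Lemma continuous_expXn_expRN A n : continuous (fun x : R => x ^+ n * expR (- A * x)).
Proof.
move=> x; apply: cvgM; first exact: exprn_continuous.
apply: (cvg_comp (fun x => - A * x) expR); last exact: continuous_expR.
by apply: cvgMr; exact: cvg_id.
Qed.

Lemma integral_expXn_expRN A n : 0 < A ->
  (\int[lebesgue_measure]_(x in `[0%R, +oo[) (x ^+ n * expR (- A * x))%:E =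
   (n`!%:R / A ^+ n.+1)%:E)%E.
Proof.
move=> A0.
rewrite (@ge0_continuous_FTC2y _ _ (gamma_prim A n.+1) _ 0).
- by rewrite gamma_prim0// sub0e EFinN oppeK.
- by move=> x x0; rewrite mulr_ge0 ?exprn_ge0 ?expR_ge0.
- exact/continuous_subspaceT/continuous_expXn_expRN.
- exact: cvg_gamma_prim.
- by move=> x _; have /@ex_derive := is_derive_gamma_prim n x A0.
- by apply: cvg_at_right_filter; exact: continuous_gamma_prim.
- move=> x _; rewrite derive1E.
  by have /@derive_val := is_derive_gamma_prim n x A0.
Qed.

(** The change of variable produced by a Gaussian average of variance b/2: the
rate l of a Gaussian kernel becomes l / (1 + b l). *)
Let compress b x := x / (1 + b * x).

Let compress_den b x : 0 < b -> 0 <= x -> 0 < 1 + b * x.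
Proof. by move=> b0 x0; rewrite ltr_wpDr// mulr_ge0// ltW. Qed.

Let is_derive_compress b x : 0 < b -> 0 <= x ->
  is_derive x 1 (compress b) ((1 + b * x) ^- 2).
Proof.
move=> b0 x0; have d0 := compress_den b0 x0.
have dn0 : 1 + b * x != 0 by rewrite gt_eqF.
have dV := is_deriveV dn0.
rewrite /compress; apply: is_derive_eq; rewrite /GRing.scale/=.
by field.
Qed.

Let continuous_compress b x : 0 < b -> 0 <= x -> {for x, continuous (compress b)}.
Proof.
move=> b0 x0; apply: differentiable_continuous.
by apply/derivable1_diffP; have /@ex_derive := is_derive_compress b0 x0.
Qed.

Lemma within_continuous_compressed A b n : 0 < b ->
  {within `[0, +oo[, continuous (fun x =>
    (x / (1 + b * x)) ^+ n * expR (- A * (x / (1 + b * x))) / (1 + b * x) ^+ 2)}.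
Proof.
move=> b0; apply/continuous_in_subspaceT => x; rewrite inE/= in_itv/= andbT => x0.
have d0 := compress_den b0 x0.
apply: cvgM.
  apply: (cvg_comp (compress b) (fun y => y ^+ n * expR (- A * y))
    (continuous_compress b0 x0)).
  exact: continuous_expXn_expRN.
apply: cvgV; first by rewrite expf_neq0// gt_eqF.
apply: (cvg_comp (fun y => 1 + b * y) (fun y => y ^+ 2)).
  by apply: cvgD; [exact: cvg_cst|apply: cvgMr; exact: cvg_id].
exact: exprn_continuous.
Qed.

(** The integrand is the derivative of the primitive [gamma_prim] composed with
x / (1 + b x), which increases from 0 to 1 / b only: the gamma integral is
truncated at 1 / b. *)
Lemma integral_compressed_le A b n : 0 < A -> 0 < b ->
  (\int[lebesgue_measure]_(x in `[0%R, +oo[)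
     ((x / (1 + b * x)) ^+ n * expR (- A * (x / (1 + b * x))) / (1 + b * x) ^+ 2)%:E <=
   (n`!%:R / A ^+ n.+1)%:E)%E.
Proof.
move=> A0 b0.
pose u := compress b; have den x := @compress_den b x b0.
have du x := @is_derive_compress b x b0.
have dG x : 0 <= x -> is_derive x 1 (gamma_prim A n.+1 \o u)
    (u x ^+ n * expR (- A * u x) / (1 + b * x) ^+ 2).
  move=> x0; have := du _ x0 => h.
  have hg := is_derive_gamma_prim n (u x) A0.
  apply: is_derive_eq.
  by rewrite /GRing.scale/= mulrC.
have cG x : 0 <= x -> {for x, continuous (gamma_prim A n.+1 \o u)}.
  move=> x0; apply: differentiable_continuous.
  by apply/derivable1_diffP; have /@ex_derive := dG _ x0.
rewrite (@ge0_continuous_FTC2y _ _ (gamma_prim A n.+1 \o u) _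
  (gamma_prim A n.+1 b^-1)).
- rewrite /comp [u 0]mul0r gamma_prim0// EFinN oppeK -EFinD lee_fin gerDr.
  by rewrite gamma_prim_le0// invr_ge0 ltW.
- move=> x x0; have d0 := den _ x0.
  by rewrite !(mulr_ge0, exprn_ge0, expR_ge0, invr_ge0, divr_ge0, x0, ltW d0).
- exact: within_continuous_compressed.
- apply: (cvg_comp u (gamma_prim A n.+1)); last first.
    exact: continuous_gamma_prim.
  apply/cvgrPdist_le => e e0; near=> x.
  have x0 : 0 < x by near: x; exact: nbhs_pinfty_gt.
  have d0 := den _ (ltW x0).
  have -> : b^-1 - u x = (b * (1 + b * x))^-1.
    by rewrite /u /compress; field; rewrite !gt_eqF.
  have xe : (b * e)^-1 / b <= x by near: x; apply: nbhs_pinfty_ge; exact: num_real.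
  rewrite ger0_norm ?invr_ge0 ?mulr_ge0 ?(ltW b0) ?(ltW d0)//.
  rewrite invfM -ler_pdivlMl ?invr_gt0// invrK -[leRHS]invrK lef_pV2 ?posrE// ?invr_gt0 ?mulr_gt0//.
  by move: xe; rewrite ler_pdivrMr// => /le_trans; apply; rewrite mulrC lerDr.
- by move=> x /ltW x0; have /@ex_derive := dG _ x0.
- by apply: cvg_at_right_filter; apply: cG.
- move=> x; rewrite in_itv/= andbT => /ltW x0; rewrite derive1E.
  by have /@derive_val := dG _ x0.
Unshelve. all: by end_near. Qed.
End laplace.

(** * Gaussian averages of Gaussian kernels *)

Section density.
Import HBNNSimple.

Lemma ge0_integral_density {R : realType} (d : measure_display) (T : measurableType d)
    (mu nu : {measure set T -> \bar R}) (p : T -> R) (f : T -> \bar R) :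
  measurable_fun setT p -> (forall x, 0 <= p x) ->
  (forall A, measurable A -> nu A = (\int[mu]_(x in A) (p x)%:E)%E) ->
  measurable_fun setT f -> (forall x, (0 <= f x)%E) ->
  (\int[nu]_x f x = \int[mu]_x (f x * (p x)%:E))%E.
Proof.
move=> mp p0 nuE mf f0.
have mpE : measurable_fun setT (EFin \o p) by exact/measurable_EFinP.
pose f_ := nnsfun_approx measurableT mf.
transitivity (lim ((\int[nu]_x (f_ n x)%:E)%E @[n --> \oo])).
  rewrite -monotone_convergence//=.
  - apply: eq_integral => x _; apply/esym/cvg_lim => //.
    exact: cvg_nnsfun_approx.
  - by move=> n; exact/measurable_EFinP/measurable_funTS.
  - by move=> n x _; rewrite lee_fin.
  - by move=> x _ m n mn; rewrite lee_fin; exact/lefP/nd_nnsfun_approx.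
transitivity (lim ((\int[mu]_x ((f_ n x)%:E * (p x)%:E))%E @[n --> \oo])); last first.
  rewrite -monotone_convergence//=.
  - apply: eq_integral => x _; apply/cvg_lim => //.
    by apply: cvgeZr => //; exact: cvg_nnsfun_approx.
  - move=> n; apply: emeasurable_funM => //.
    exact/measurable_EFinP/measurable_funTS.
  - by move=> n x _; rewrite mule_ge0// lee_fin.
  - move=> x _ m n mn; apply: lee_wpmul2r; first by rewrite lee_fin.
    by rewrite lee_fin; exact/lefP/nd_nnsfun_approx.
apply: congr_lim; apply/funext => n /=.
under [LHS]eq_integral do rewrite fimfunE -fsumEFin//.
rewrite [LHS]ge0_integral_fsum//; last 2 first.
  - by move=> r; exact/measurable_EFinP/measurableT_comp.
  - by move=> r x _; rewrite EFinM nnfun_muleindic_ge0.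
under [RHS]eq_integral.
  move=> x xD; rewrite fimfunE -fsumEFin// ge0_mule_fsuml; last first.
    by move=> r; rewrite EFinM nnfun_muleindic_ge0.
  over.
rewrite [RHS]ge0_integral_fsum//; last 2 first.
  - move=> r; apply: emeasurable_funM => //.
    exact/measurable_EFinP/measurableT_comp.
  - move=> r x _; rewrite mule_ge0//; last by rewrite lee_fin.
    by rewrite EFinM nnfun_muleindic_ge0.
apply: eq_fsbigr => r /[!inE]-[x _ fxr].
have r0 : 0 <= r by rewrite -fxr.
under [RHS]eq_integral do rewrite EFinM -muleA.
rewrite ge0_integralZl//; last 2 first.
- apply: emeasurable_funM => //; exact/measurable_EFinP/measurable_indic.
- by move=> y _; rewrite mule_ge0// lee_fin.
rewrite integralZl_indic_nnsfun//= integral_indic// setIT nuE//.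
congr (_ * _)%E; rewrite [LHS]integral_mkcond/=.
apply: eq_integral => y _; rewrite patchE indicE.
by case: ifPn => /=; rewrite ?mul1e ?mul0e.
Qed.

End density.

Section gaussian.
Context {R : realType}.
Implicit Types (a s l : R).

(** Completing the square: with c = 1 + 2 s^2 l the product of the kernel and the
standard normal density is a constant multiple of the normal density of mean
- 2 l s a / c and variance 1 / c. *)
Lemma integral_normal_expR_sqr a s l : 0 <= l ->
  (\int[normal_prob (0 : R) 1]_x (expR (- l * (a + s * x) ^+ 2))%:E =
   ((Num.sqrt (1 + 2 * s ^+ 2 * l))^-1 *
    expR (- l * a ^+ 2 / (1 + 2 * s ^+ 2 * l)))%:E)%E.
Proof.
move=> l0; set c := 1 + 2 * s ^+ 2 * l.
have c0 : 0 < c by rewrite ltr_wpDr// mulr_ge0// mulr_ge0// sqr_ge0.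
have cn0 : c != 0 by rewrite gt_eqF.
have sc0 : 0 < Num.sqrt c by rewrite sqrtr_gt0.
have mE : measurable_fun setT (fun x : R => expR (- l * (a + s * x) ^+ 2)).
  apply: measurableT_comp => //; apply: measurable_funM => //.
  by apply: measurable_funX; apply: measurable_funD => //; exact: measurable_funM.
rewrite (ge0_integral_density (mu := lebesgue_measure) (p := normal_pdf 0 1))//; last 3 first.
- exact: measurable_normal_pdf.
- exact: normal_pdf_ge0.
- exact/measurable_EFinP.
set C := _ * _.
transitivity (\int[lebesgue_measure]_x
   (C%:E * (normal_pdf (- (2 * l * s * a / c)) (Num.sqrt c)^-1 x)%:E))%E.
  apply: eq_integral => x _; rewrite -!EFinM; congr EFin.
  rewrite !normal_pdfE ?oner_neq0 ?invr_neq0 ?gt_eqF// /normal_peak /normal_fun /C.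
  rewrite mulrACA -!expRD mulrCA -expRD.
  rewrite exprVn sqr_sqrtr ?(ltW c0)//.
  congr (_ * _).
    rewrite expr1n mul1r -mulrnAr sqrtrM ?invr_ge0 ?(ltW c0)// sqrtrV ?(ltW c0)//.
    field.
    by rewrite !gt_eqF// sqrtr_gt0 pmulrn_lgt0// pi_gt0.
  congr expR.
  rewrite -[in RHS]mulr_natr /c; field.
  exact: cn0.
rewrite ge0_integralZl//.
- by rewrite integral_normal_pdf mule1.
- by apply/measurable_EFinP; exact: measurable_normal_pdf.
- by move=> x _; rewrite lee_fin normal_pdf_ge0.
- by rewrite lee_fin mulr_ge0 ?expR_ge0 ?invr_ge0 ?sqrtr_ge0.
Qed.
End gaussian.

Section measurability_rV.
Context {R : realType} {d : measure_display} {T : measurableType d} (n : nat).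
Implicit Types f g : T -> 'rV[R]_n.

Lemma measurable_rVD f g : measurable_fun setT f -> measurable_fun setT g ->
  measurable_fun setT (fun x => f x + g x).
Proof.
move=> /measurable_fun_rVP mf /measurable_fun_rVP mg; apply/measurable_fun_rVP => i.
under eq_fun do rewrite mxE.
exact: measurable_funD.
Qed.

Lemma measurable_rVZ (k : T -> R) f : measurable_fun setT k -> measurable_fun setT f ->
  measurable_fun setT (fun x => k x *: f x).
Proof.
move=> mk /measurable_fun_rVP mf; apply/measurable_fun_rVP => i.
under eq_fun do rewrite mxE.
exact: measurable_funM.
Qed.

Lemma measurable_dot f g : measurable_fun setT f -> measurable_fun setT g ->
  measurable_fun setT (fun x => dot (f x) (g x)).
Proof.
move=> /measurable_fun_rVP mf /measurable_fun_rVP mg; rewrite /dot.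
by apply: measurable_sum => i; exact: measurable_funM.
Qed.

End measurability_rV.

Section gaussian_rV.
Context {R : realType}.

Lemma dot_ge0 n (x : 'rV[R]_n) : 0 <= dot x x.
Proof. by apply: sumr_ge0 => i _; rewrite -expr2 sqr_ge0. Qed.

Lemma dot_eq0 n (x : 'rV[R]_n) : (dot x x == 0) = (x == 0).
Proof.
apply/idP/eqP => [|->]; last by rewrite /dot big1// => i _; rewrite mxE mul0r.
rewrite psumr_eq0 => [/allP h|i _]; last by rewrite -expr2 sqr_ge0.
apply/rowP => i; have := h i; rewrite mem_index_enum => /(_ isT).
by rewrite mxE -expr2 sqrf_eq0 => /eqP.
Qed.

Lemma dot_gt0 n (x : 'rV[R]_n) : x != 0 -> 0 < dot x x.
Proof. by rewrite lt_def dot_ge0 andbT dot_eq0. Qed.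

Lemma dot_rV_cons n (m : 'rV[R]_n.+1) (s x : R) (v : 'rV[R]_n) :
  let m' := \row_j m ord0 (lift ord0 j) in
  dot (m + s *: rV_cons (x, v)) (m + s *: rV_cons (x, v)) =
  (m ord0 ord0 + s * x) ^+ 2 + dot (m' + s *: v) (m' + s *: v).
Proof.
move=> m'; have E i : (m + s *: rV_cons (x, v)) ord0 i =
    m ord0 i + s * rV_cons (x, v) ord0 i.
  by rewrite mxE [X in _ + X]mxE.
rewrite /dot big_ord_recl !E rV_cons0 -expr2; congr (_ + _).
by apply: eq_bigr => i _; rewrite E rV_consS !mxE.
Qed.

Lemma measurable_gauss_kernel n (m : 'rV[R]_n) (s l : R) :
  measurable_fun setT (fun z : 'rV[R]_n => expR (- l * dot (m + s *: z) (m + s *: z))).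
Proof.
apply: measurableT_comp => //; apply: measurable_funM => //.
by apply: measurable_dot; apply: measurable_rVD => //; exact: measurable_rVZ.
Qed.

(** The kernel factors over coordinates, so the one-dimensional formula is applied
once per coordinate through the recursive product structure of [std_normal]. *)
Lemma integral_std_normal_expR n (m : 'rV[R]_n) (s l : R) : 0 <= l ->
  (\int[std_normal n]_z (expR (- l * dot (m + s *: z) (m + s *: z)))%:E =
   ((Num.sqrt (1 + 2 * s ^+ 2 * l) ^+ n)^-1 *
    expR (- l * dot m m / (1 + 2 * s ^+ 2 * l)))%:E)%E.
Proof.
move=> l0; elim: n m => [|n ih] m.
  rewrite integral_dirac// ?diracT ?mul1e; last first.
    by apply/measurable_EFinP; exact: measurable_gauss_kernel.
  by rewrite /dot !big_ord0 mulr0 mul0r expr0 invr1 mul1r.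
rewrite ge0_integral_distribution//=; last first.
  by apply/measurable_EFinP; exact: measurable_gauss_kernel.
rewrite -/(@std_normal R) fubini_tonelli1//=; last first.
  apply/measurable_EFinP.
  by apply: (measurableT_comp (measurable_gauss_kernel m s l)).
rewrite /fubini_F/=.
set m' := \row_j m ord0 (lift ord0 j).
set c := 1 + 2 * s ^+ 2 * l.
have sc0 : 0 <= (Num.sqrt c ^+ n)^-1 * expR (- l * dot m' m' / c).
  by rewrite mulr_ge0 ?expR_ge0// invr_ge0 exprn_ge0// sqrtr_ge0.
transitivity (\int[normal_prob (0 : R) 1]_x ((expR (- l * (m ord0 ord0 + s * x) ^+ 2))%:E *
  ((Num.sqrt c ^+ n)^-1 * expR (- l * dot m' m' / c))%:E))%E.
  apply: eq_integral => x _; rewrite -ih -ge0_integralZl//; last first.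
    by apply/measurable_EFinP; exact: measurable_gauss_kernel.
  by apply: eq_integral => z _; rewrite dot_rV_cons -EFinM -expRD -mulrDr.
rewrite ge0_integralZr//; last first.
  apply/measurable_EFinP; apply: measurableT_comp => //; apply: measurable_funM => //.
  by apply: measurable_funX; apply: measurable_funD => //; exact: measurable_funM.
rewrite integral_normal_expR_sqr// -EFinM mulrACA -expRD -invfM -exprS -/c.
suff -> : dot m m = m ord0 ord0 ^+ 2 + dot m' m' by rewrite -mulrDl -mulrDr.
rewrite /dot big_ord_recl -expr2; congr (_ + _).
by apply: eq_bigr => i _; rewrite !mxE.
Qed.

End gaussian_rV.

(** * Superharmonicity and the growth of the potential in one step *)

Section one_step.
Context {R : realType}.

(** The Riesz kernel n! / |y|^(2(n+1)) as a mixture of Gaussian kernels; the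
integral form gives the value +oo at the pole and can be averaged kernel by
kernel. *)
Definition riesz n d (y : 'rV[R]_d) : \bar R :=
  (\int[lebesgue_measure]_(l in `[0%R, +oo[) (l ^+ n * expR (- dot y y * l))%:E)%E.

Let fact_gt0R n : 0 < n`!%:R :> R.
Proof. by rewrite ltr0n fact_gt0. Qed.

Lemma rieszE n d (y : 'rV[R]_d) : y != 0 ->
  riesz n y = (n`!%:R / dot y y ^+ n.+1)%:E.
Proof. by move=> y0; rewrite /riesz integral_expXn_expRN// dot_gt0. Qed.

Let measurable_riesz_integrand n d :
  measurable_fun setT (fun zl : 'rV[R]_d * measurableTypeR R =>
    (zl.2 ^+ n * expR (- dot zl.1 zl.1 * zl.2))%:E).
Proof.
apply/measurable_EFinP; apply: measurable_funM => //.
  by apply: measurable_funX; exact: measurable_snd.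
apply: measurableT_comp => //; apply: measurable_funM => //.
by apply: measurableT_comp => //; apply: measurable_dot; exact: measurable_fst.
Qed.

Lemma riesz0 n d : riesz n (0 : 'rV[R]_d) = +oo%E.
Proof.
apply/eqyP => A A0.
(* With r <= 1 one has r^(n+1) <= r <= n! / A, so the kernel value at squared
   distance r, which bounds the value at 0 from below, is at least A. *)
pose r : R := Num.min 1 (n`!%:R / A).
have r0 : 0 < r by rewrite lt_min ltr01 divr_gt0.
have -> : riesz n (0 : 'rV[R]_d) = (\int[lebesgue_measure]_(l in `[0%R, +oo[) (l ^+ n)%:E)%E.
  apply: eq_integral => l _.
  by rewrite (_ : dot 0 0 = 0) ?oppr0 ?mul0r ?expR0 ?mulr1//; apply/eqP; rewrite dot_eq0.
apply: (@le_trans _ _ (n`!%:R / r ^+ n.+1)%:E).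
  rewrite lee_fin ler_pdivlMr ?exprn_gt0// -ler_pdivlMl//.
  apply: (@le_trans _ _ r); last by rewrite mulrC /r ge_min lexx orbT.
  by rewrite exprS ger_pMr// exprn_ile1// ?(ltW r0)// /r ge_min lexx.
rewrite -integral_expXn_expRN//; apply: ge0_le_integral => //=.
- by move=> l; rewrite in_itv/= andbT => l0; rewrite lee_fin mulr_ge0 ?expR_ge0 ?exprn_ge0.
- apply/measurable_EFinP; apply: measurable_funTS.
  apply: continuous_measurable_fun; exact: continuous_expXn_expRN.
- by apply/measurable_EFinP; apply: measurable_funTS; exact: measurable_funX.
- move=> l; rewrite in_itv/= andbT => l0; rewrite lee_fin ler_piMr ?exprn_ge0//.
  by rewrite expR_le1 mulNr oppr_le0 mulr_ge0// ltW.
Qed.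

Lemma riesz_ge0 n d (y : 'rV[R]_d) : (0 <= riesz n y)%E.
Proof.
apply: integral_ge0 => l; rewrite /= in_itv/= andbT => l0.
by rewrite lee_fin mulr_ge0 ?expR_ge0 ?exprn_ge0.
Qed.

(** The integrand of [riesz] extended by 0 to negative rates, so that Tonelli
applies on a full product space. *)
Let joint n d (zl : 'rV[R]_d * measurableTypeR R) : \bar R :=
  ((fun zl => (zl.2 ^+ n * expR (- dot zl.1 zl.1 * zl.2))%:E)
     \_ ([set: 'rV[R]_d] `*` `[0%R, +oo[)) zl.

Let measurable_joint n d : measurable_fun setT (@joint n d).
Proof.
apply/(measurable_restrictT _ _).1; first exact: measurableX.
by apply: measurable_funTS; exact: measurable_riesz_integrand.
Qed.

Let joint_ge0 n d zl : (0 <= @joint n d zl)%E.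
Proof.
rewrite /joint patchE; case: ifPn => //; rewrite inE/= in_itv/= andbT => -[_ l0].
by rewrite lee_fin mulr_ge0 ?expR_ge0 ?exprn_ge0.
Qed.

Let riesz_joint n d (y : 'rV[R]_d) :
  riesz n y = (\int[lebesgue_measure]_l joint n (y, l))%E.
Proof.
rewrite /riesz integral_mkcond/=; apply: eq_integral => l _.
by rewrite /joint !patchE in_setX/= in_setT.
Qed.

Lemma measurable_riesz n d : measurable_fun setT (@riesz n d).
Proof.
rewrite (_ : @riesz n d = fubini_F lebesgue_measure (@joint n d)).
  by apply: measurable_fun_fubini_tonelli_F => //; exact: measurable_joint.
by apply/funext => y; rewrite riesz_joint.
Qed.

(** The average of the kernel of rate l decays like (1 + b l)^(-d/2), b = 2 s^2.
The condition 2(n+2) <= d bounds this by (1 + b l)^(-n) (1 + b l)^(-2), which is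
exactly what the substitution l / (1 + b l) absorbs. *)
Lemma riesz_superharmonic n d (m : 'rV[R]_d) (s : R) :
  (n.+2.*2 <= d)%N -> m != 0 -> 0 < s ->
  (\int[std_normal d]_z riesz n (m + s *: z) <= riesz n m)%E.
Proof.
move=> nd m0 s0; have q0 := dot_gt0 m0.
have mT : measurable_fun setT (fun z : 'rV[R]_d => m + s *: z).
  by apply: measurable_rVD => //; exact: measurable_rVZ.
under eq_integral do rewrite riesz_joint.
pose f (zl : 'rV[R]_d * measurableTypeR R) := joint n (m + s *: zl.1, zl.2).
have mf : measurable_fun setT f.
  apply: (measurableT_comp (measurable_joint n (d:=d))).
  by apply: measurable_fun_pair => //; exact: (measurableT_comp mT measurable_fst).
have f0 zl : (0 <= f zl)%E by exact: joint_ge0.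
rewrite (@fubini_tonelli _ _ _ _ _ (std_normal d) lebesgue_measure f)//.
pose b := 2 * s ^+ 2.
have b0 : 0 < b by rewrite mulr_gt0// exprn_gt0.
apply: (@le_trans _ _ (\int[lebesgue_measure]_(l in `[0%R, +oo[)
   ((l / (1 + b * l)) ^+ n * expR (- dot m m * (l / (1 + b * l))) / (1 + b * l) ^+ 2)%:E)%E); last first.
  by rewrite rieszE//; exact: integral_compressed_le.
rewrite [leRHS]integral_mkcond/=; apply: ge0_le_integral => //=.
- by move=> l _; apply: integral_ge0 => z _; exact: joint_ge0.
- exact: (measurable_fun_fubini_tonelli_G (m1 := std_normal d) f mf f0).
- apply/(measurable_restrictT _ _).1 => //; apply/measurable_EFinP.
  apply: subspace_continuous_measurable_fun => //.
  exact: within_continuous_compressed.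
- move=> l _; rewrite patchE; case: ifPn => l0; last first.
    rewrite integral0_eq// => z _.
    by rewrite /f /joint patchE in_setX/= (negbTE l0) andbF.
  have lin := l0; have {}l0 : 0 <= l by move: l0; rewrite inE/= in_itv/= andbT.
  set c := 1 + b * l; have c1 : 1 <= c by rewrite lerDl mulr_ge0// ltW.
  have c0 : 0 < c by exact: lt_le_trans c1.
  have mE := measurable_gauss_kernel m s l.
  rewrite [leLHS](_ : _ = \int[std_normal d]_z ((l ^+ n)%:E *
      (expR (- l * dot (m + s *: z) (m + s *: z)))%:E))%E; last first.
    apply: eq_integral => z _; rewrite /f /joint patchE in_setX/= lin in_setT/=.
    by rewrite EFinM mulNr mulrC mulNr.
  rewrite ge0_integralZl//; last 2 first.
  + exact/measurable_EFinP.
  + by rewrite lee_fin exprn_ge0.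
  rewrite integral_std_normal_expR// -/b -/c -EFinM lee_fin.
  have -> : - l * dot m m / c = - dot m m * (l / c) by rewrite mulNr mulrC; ring.
  rewrite mulrA [leRHS]mulrAC; apply: ler_wpM2r; first exact: expR_ge0.
  rewrite expr_div_n -mulrA -invfM -exprD ler_wpM2l ?exprn_ge0//.
  rewrite lef_pV2 ?posrE ?exprn_gt0 ?sqrtr_gt0//.
  rewrite addn2 -[in leLHS](sqr_sqrtr (ltW c0)) -exprM mul2n.
  by rewrite ler_weXn2l// -sqrtr1 ler_wsqrtr.
Qed.


(** This is |y|^(-2p). The value +oo at 0 makes a finite expectation exclude
reaching the optimum; the total function [powR] would give 0 there. *)
Definition potential p d (y : 'rV[R]_d) : \bar R :=
  if dot y y == 0 then +oo%E else (dot y y `^ (- p))%:E.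

Lemma potential0 p d : potential p (0 : 'rV[R]_d) = +oo%E.
Proof. by rewrite /potential dot_eq0 eqxx. Qed.

Lemma potentialE p d (y : 'rV[R]_d) : y != 0 -> potential p y = (dot y y `^ (- p))%:E.
Proof. by rewrite -dot_eq0 /potential => /negbTE ->. Qed.

Lemma potential_ge0 p d (y : 'rV[R]_d) : (0 <= potential p y)%E.
Proof. by rewrite /potential; case: ifP => // _; rewrite lee_fin powR_ge0. Qed.

Lemma measurable_potential p d : measurable_fun setT (@potential p d).
Proof.
have mdot : measurable_fun setT (fun y : 'rV[R]_d => dot y y) by exact: measurable_dot.
apply: measurable_fun_ifT => //; first exact: measurable_fun_eqr.
by apply/measurable_EFinP; exact: (measurableT_comp (measurable_powR _)).
Qed.

(** The slope of the line through (0, 1) tangent to the graph of W^(1/5). *)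
Definition tangent_slope : R := (4 / 5) ^+ 4 / 5.

Lemma tangent_slope_gt0 : 0 < tangent_slope.
Proof. by rewrite /tangent_slope divr_gt0// exprn_gt0// divr_gt0. Qed.

(** Stated in x = W^(1/5): the tangency point is x = 5/4, which is the double root
of the difference. *)
Lemma le_tangent_fifth_root (x : R) : 0 <= x -> x <= 1 + tangent_slope * x ^+ 5.
Proof. rewrite /tangent_slope.
move=> x0; rewrite -subr_ge0.
have -> : 1 + (4 / 5) ^+ 4 / 5 * x ^+ 5 - x = (4 * x / 5 - 1) ^+ 2 *
   ((4 * x / 5) ^+ 3 + 2 * (4 * x / 5) ^+ 2 + 3 * (4 * x / 5) + 4) / 4 by field.
rewrite mulr_ge0 ?invr_ge0// mulr_ge0 ?sqr_ge0//.
by rewrite !(addr_ge0, mulr_ge0, exprn_ge0, invr_ge0).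
Qed.

(** The tangent-line bound max(1, W^(1/5)) <= 1 + c W, multiplied by the potential
of m, where W = (|m| / |y|)^(2(n+1)). *)
Lemma max_potential_le n d (m y : 'rV[R]_d) : m != 0 ->
  (maxe (potential (n.+1%:R / 5) m) (potential (n.+1%:R / 5) y) <=
   potential (n.+1%:R / 5) m +
   (dot m m `^ (- (n.+1%:R / 5)) * (tangent_slope) * (dot m m ^+ n.+1 / n`!%:R))%:E
   * riesz n y)%E.
Proof.
set p := n.+1%:R / 5; set C := (X in (_ <= _ + X%:E * _)%E) => m0.
have qm0 := dot_gt0 m0.
have C0 : 0 < C by rewrite /C !(mulr_gt0, powR_gt0, exprn_gt0, invr_gt0)//.
have [->|y0] := eqVneq y 0.
  by rewrite riesz0 gt0_muley ?lte_fin// potentialE// addey// leey.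
have qy0 := dot_gt0 y0.
rewrite !potentialE// rieszE// -EFinM -EFinD -EFin_max lee_fin.
pose w := (dot m m / dot y y) `^ p.
have w0 : 0 <= w by exact: powR_ge0.
have w5 : w ^+ 5 = (dot m m / dot y y) ^+ n.+1.
  rewrite -!powR_mulrn ?divr_ge0 ?(ltW qm0) ?(ltW qy0)// /w -powRrM.
  by rewrite /p divfK.
have -> : dot y y `^ (- p) = dot m m `^ (- p) * w.
  rewrite /w powRM ?invr_ge0 ?(ltW qm0) ?(ltW qy0)// mulrA -powRD; last first.
    by rewrite (gt_eqF qm0) implybT.
  rewrite addNr powRr0 mul1r.
  by rewrite powRN -(powR_inv1 (ltW qy0)) -powRrM mulN1r powRN.
have -> : C * (n`!%:R / dot y y ^+ n.+1) = dot m m `^ (- p) * (tangent_slope * w ^+ 5).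
  rewrite w5 expr_div_n /C; field.
  by rewrite (gt_eqF (fact_gt0R n)) gt_eqF ?exprn_gt0.
set v := _ `^ _; have v0 : 0 <= v by exact: powR_ge0.
rewrite -[X in X + _]mulr1 -mulrDr ge_max; apply/andP; split.
  by rewrite -[leLHS]mulr1 ler_wpM2l// lerDl mulr_ge0 ?exprn_ge0// ltW// tangent_slope_gt0.
by rewrite ler_wpM2l// le_tangent_fifth_root.
Qed.

Lemma expected_max_potential_le n d (m : 'rV[R]_d) (s : R) :
  (n.+2.*2 <= d)%N -> 0 < s ->
  (\int[std_normal d]_z
     maxe (potential (n.+1%:R / 5) m) (potential (n.+1%:R / 5) (m + s *: z)) <=
   (1 + tangent_slope)%:E * potential (n.+1%:R / 5) m)%E.
Proof.
set p := n.+1%:R / 5 => nd s0.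
have [->|m0] := eqVneq m 0.
  by rewrite potential0 gt0_muley ?leey// lte_fin addr_gt0// tangent_slope_gt0.
have qm0 := dot_gt0 m0.
have mT : measurable_fun setT (fun z : 'rV[R]_d => m + s *: z).
  by apply: measurable_rVD => //; exact: measurable_rVZ.
pose C := dot m m `^ (- p) * (tangent_slope) * (dot m m ^+ n.+1 / n`!%:R).
have C0 : 0 < C by rewrite /C !(mulr_gt0, powR_gt0, exprn_gt0, invr_gt0)//.
have mN : measurable_fun setT (fun z : 'rV[R]_d => riesz n (m + s *: z)).
  exact: (measurableT_comp (measurable_riesz n (d:=d))).
apply: (@le_trans _ _ (\int[std_normal d]_z
    (potential p m + C%:E * riesz n (m + s *: z)))%E).
  apply: ge0_le_integral => //.
  - by move=> z _; rewrite le_max potential_ge0.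
  - apply: measurable_maxe => //.
    exact: (measurableT_comp (measurable_potential p (d:=d))).
  - by apply: emeasurable_funD => //; exact: measurable_funeM.
  - by move=> z _; exact: max_potential_le.
rewrite ge0_integralD//; last 3 first.
- by move=> z _; exact: potential_ge0.
- by move=> z _; rewrite mule_ge0 ?riesz_ge0// lee_fin ltW.
- exact: measurable_funeM.
rewrite integral_cst// [X in (_ * X + _)%E](_ : _ = 1%E) ?mule1; last exact: probability_setT.
rewrite ge0_integralZl//; last 2 first.
- by move=> z _; exact: riesz_ge0.
- by rewrite lee_fin ltW.
rewrite EFinD potentialE// muleDl// mul1e leeD2l//.
apply: (@le_trans _ _ (C%:E * riesz n m)%E).
  by rewrite lee_pmul2l ?lte_fin// riesz_superharmonic.
rewrite rieszE// -!EFinM lee_fin /C le_eqVlt; apply/orP; left; apply/eqP.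
by field; rewrite (gt_eqF (fact_gt0R n)) gt_eqF ?exprn_gt0.
Qed.
End one_step.

(** * Independence of the past *)

Section independent_pair.
Context {d1 d2 d3 : measure_display} {T : measurableType d1}
  {V : measurableType d2} {W : measurableType d3} {R : realType}
  (P : probability T R).

(** The law of an independent pair is the product of its marginals, and Tonelli
integrates the second variable first. *)
Lemma ge0_integral_indep_pair (X : {RV P >-> V}) (Z : {RV P >-> W}) (g : V * W -> \bar R) :
  (forall A B, measurable A -> measurable B ->
     P (X @^-1` A `&` Z @^-1` B) = (P (X @^-1` A) * P (Z @^-1` B))%E) ->
  measurable_fun setT g -> (forall x, (0 <= g x)%E) ->
  (\int[P]_w g (X w, Z w) = \int[P]_w \int[distribution P Z]_y g (X w, y))%E.
Proof.
move=> ind mg g0.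
have mXZ : measurable_fun setT (fun w => (X w, Z w)) by exact: measurable_fun_pair.
pose XZ : {RV P >-> (V * W)%type} :=
  HB.pack (fun w => (X w, Z w)) (isMeasurableFun.Build _ _ _ _ (fun w => (X w, Z w)) mXZ).
rewrite -(@ge0_integral_distribution _ _ _ _ _ P XZ g)//.
rewrite (eq_measure_integral (distribution P X \x distribution P Z)%E); last first.
  move=> D mD _; apply/esym; apply: product_measure_unique => //.
rewrite fubini_tonelli1// ge0_integral_distribution//.
- exact: measurable_fun_fubini_tonelli_F.
- by move=> x; exact: integral_ge0.
Qed.
End independent_pair.

Section past.
Context {disp disp' : measure_display} {T : measurableType disp}
  {U : measurableType disp'} {R : realType} {P : probability T R}
  (z : nat -> {RV P >-> U}).

(** Events that constrain each of z_0, ..., z_(t-1) separately: a pi-system that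
generates the sigma-algebra of the past. *)
Definition past (t : nat) : set (set T) :=
  [set A | exists2 B : nat -> set U, (forall i, measurable (B i)) &
           A = \bigcap_(i < t) (z i @^-1` B i)].

Lemma past_setT t : past t setT.
Proof. by exists (fun=> setT) => //; rewrite bigcapT. Qed.

Lemma past_setI_closed t : setI_closed (past t).
Proof.
move=> _ _ [A mA ->] [B mB ->]; exists (fun i => A i `&` B i).
  by move=> i; exact: measurableI.
by rewrite -bigcapI.
Qed.

Lemma past_measurable t : past t `<=` measurable.
Proof.
move=> _ [B mB ->]; apply: fin_bigcap_measurable => // i _.
by rewrite -[X in measurable X]setTI; exact: measurable_funPT.
Qed.

Lemma past_subS t : past t `<=` past t.+1.
Proof.
move=> _ [B mB ->]; exists (fun i => if i == t then setT else B i).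
  by move=> i; case: ifP.
apply/seteqP; split => w h i /= it.
  case: eqP => // /eqP itn; apply: h => /=.
  by rewrite ltn_neqAle itn -ltnS.
by have := h i (ltnW it); rewrite /= ltn_eqF.
Qed.

Lemma past_last t B : measurable B -> past t.+1 (z t @^-1` B).
Proof.
move=> mB; exists (fun i => if i == t then B else setT).
  by move=> i; case: ifP.
apply/seteqP; split => w.
  by move=> h i _ /=; case: eqP => // ->.
by move=> /(_ t (ltnSn t)) /=; rewrite eqxx.
Qed.

(** On boxes this is mutual independence. Both sides are finite measures in A, so
they agree on the generated sigma-algebra. *)
Lemma past_indep t A B : mutually_independent z ->
  <<s past t>> A -> measurable B ->
  P (A `&` z t @^-1` B) = (P A * P (z t @^-1` B))%E.
Proof.
move=> ind sA mB.
have mZ : measurable (z t @^-1` B).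
  by rewrite -[X in measurable X]setTI; exact: measurable_funPT.
pose k : {nonneg R} := NngNum (fine_ge0 (measure_ge0 P (z t @^-1` B))).
have kE C : mscale k P C = (P C * P (z t @^-1` B))%E.
  by rewrite /mscale/= fineK ?fin_num_measure// muleC.
rewrite -kE -[LHS]/(mrestr P mZ A).
apply: (g_sigma_algebra_measure_unique (past t) _ (fun=> setT) _ _ (mrestr P mZ) (mscale k P)) sA.
- exact: past_measurable.
- by move=> n; exact: past_setT.
- by rewrite bigcup_const//; exists 0%N.
- exact: past_setI_closed.
- have bigcap_iota (n : nat) (F : nat -> set T) :
      \bigcap_(i < n) F i = \bigcap_(i in [set` iota 0 n]) F i.
    by rewrite (_ : [set` iota 0 n] = `I_n)//; apply/seteqP; split => i /=; rewrite mem_iota.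
  move=> _ [C mC ->]; apply: etrans (esym (kE _)); rewrite bigcap_iota /mrestr.
  pose D i := if i == t then B else C i.
  have DC i : i \in iota 0 t -> D i = C i.
    by rewrite mem_iota add0n/= /D => /ltn_eqF ->.
  have mD i : measurable (D i) by rewrite /D; case: ifP.
  have := ind (iota 0 t.+1) D (iota_uniq _ _) mD.
  rewrite -addn1 iotaD big_cat/= big_seq1 add0n {3}/D eqxx.
  rewrite (_ : \bigcap_(i in [set` iota 0 t ++ [:: t]]) (z i @^-1` D i) =
     \bigcap_(i in [set` iota 0 t]) (z i @^-1` C i) `&` z t @^-1` B) => [e|].
    apply: (etrans e); congr (_ * _)%E; rewrite (ind _ C (iota_uniq 0 t) mC).
    by rewrite big_seq [RHS]big_seq; apply: eq_bigr => i /DC ->.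
  apply/seteqP; split => w.
    move=> h; split.
      by move=> i /= it; rewrite -DC//; apply: h => /=; rewrite mem_cat it.
    by have := h t; rewrite /= mem_cat inE eqxx orbT /D eqxx; exact.
  move=> [h1 h2] i /=; rewrite mem_cat inE => /orP[it|/eqP ->].
    by rewrite DC//; exact: h1.
  by rewrite /D eqxx.
- move=> _; apply: (@le_lt_trans _ _ 1%E _ _ _ (ltry 1)).
  apply: probability_le1.
  exact: measurableI.
Qed.

End past.

(** * From expectations to almost sure rates *)

Section limits.
Context {R : realType}.

(** The sum over t of V_t has a finite integral, hence is almost surely finite,
and it bounds each of its terms. *)
Lemma ae_bounded_of_geometric_integrals (disp : measure_display) (T : measurableType disp)
    (P : {measure set T -> \bar R}) (V : nat -> T -> \bar R) (C r : R) :
  (forall t, measurable_fun setT (V t)) -> (forall t w, (0 <= V t w)%E) ->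
  0 <= C -> 0 <= r -> r < 1 ->
  (forall t, (\int[P]_w V t w <= (C * r ^+ t)%:E)%E) ->
  {ae P, forall w, exists K : R, forall t, (V t w <= K%:E)%E}.
Proof.
move=> mV V0 C0 r0 r1 hV.
pose S w := (\sum_(t <oo) V t w)%E.
have mS : measurable_fun setT S by exact: ge0_emeasurable_sum.
have S0 w : (0 <= S w)%E by exact: nneseries_ge0.
have iS : P.-integrable setT S.
  apply/integrableP; split => //.
  under eq_integral do rewrite gee0_abs//.
  rewrite integral_nneseries//.
  apply: (@le_lt_trans _ _ (C / (1 - r))%:E); last exact: ltry.
  apply: lime_le; first by apply: is_cvg_nneseries => n _ _; exact: integral_ge0.
  apply: nearW => n.
  apply: (@le_trans _ _ (\sum_(0 <= t < n) (C * r ^+ t)%:E)%E).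
    exact: lee_sum.
  rewrite sumEFin lee_fin.
  have := geometric_seriesE C (negbT (lt_eqF r1)) => /(congr1 (fun f => f n)).
  rewrite /series/= => ->; rewrite ler_wpM2r ?invr_ge0 ?subr_ge0 ?(ltW r1)//.
  by rewrite ler_piMr// gerBl exprn_ge0.
have := integrable_ae measurableT iS.
apply: filterS => w /(_ I) Sfin; exists (fine (S w)) => t.
rewrite fineK// /S (nneseries_split _ t.+1)//.
rewrite big_nat_recr//= addeAC leeDr// adde_ge0 ?sume_ge0//.
exact: nneseries_ge0.
Qed.

Lemma limn_einf_ge_affine (u : (\bar R)^nat) (a C : R) : 0 <= C ->
  (forall t, (0 < t)%N -> ((a - C / t%:R)%:E <= u t)%E) -> (a%:E <= limn_einf u)%E.
Proof.
move=> C0 hu; apply/lee_addgt0Pr => e e0.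
rewrite -leeBlDr//.
pose N := (Num.truncn (C / e)).+1.
apply: (@le_trans _ _ (einfs u N)); last first.
  rewrite limn_einf_lim; apply: lime_ge; first exact: is_cvg_einfs.
  by exists N => // k /= Nk; exact: nondecreasing_einfs.
apply: le_ereal_inf_tmp => _ [k /= Nk <-].
have k0 : (0 < k)%N by exact: leq_trans Nk.
apply: le_trans (hu k k0); rewrite -EFinB lee_fin lerD2l lerN2.
rewrite ler_pdivrMr ?ltr0n// mulrC -ler_pdivrMr//.
apply: (@le_trans _ _ N%:R); last by rewrite ler_nat.
by rewrite ltW// real_truncnS_gt// num_real.
Qed.
End limits.

(** * The evolution strategy *)

Section ES_measurability.
Context {R : realType} {d : nat} (au ad : R) (h : 'rV[R]_d -> R).
Hypothesis mh : measurable_fun setT h.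

Lemma ES_stepE (theta : state R d) (z : 'rV[R]_d) :
  theta + ES_step au ad theta z h =
  if h (theta.1 + expR theta.2 *: z) <= h theta.1
  then (theta.1 + expR theta.2 *: z, theta.2 + ln au)
  else (theta.1, theta.2 + ln ad).
Proof.
case: theta => m s; rewrite /ES_step /mean /stepsize/=.
by case: ifP => _; congr pair; rewrite addr0.
Qed.

(** The maximum covers both outcomes of the comparison of objective values, which
removes the objective from all later estimates. *)
Lemma potential_ES_step p (x : 'rV[R]_d) (theta : state R d) (z : 'rV[R]_d) :
  (potential p (mean (theta + ES_step au ad theta z h)%R - x)%R <=
   maxe (potential p (theta.1 - x)%R)
        (potential p (theta.1 - x + expR theta.2 *: z)%R))%E.
Proof.
rewrite ES_stepE /mean; case: ifP => _ /=; last by rewrite le_max lexx.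
by rewrite (addrAC theta.1) le_max lexx orbT.
Qed.

Lemma measurable_trial : measurable_fun setT
  (fun tz : state R d * 'rV[R]_d => tz.1.1 + expR tz.1.2 *: tz.2).
Proof.
apply: measurable_rVD.
  exact: (measurableT_comp measurable_fst measurable_fst).
apply: measurable_rVZ; last exact: measurable_snd.
apply: measurableT_comp => //.
exact: (measurableT_comp measurable_snd measurable_fst).
Qed.

Lemma measurable_ES_step : measurable_fun setT
  (fun tz : state R d * 'rV[R]_d => tz.1 + ES_step au ad tz.1 tz.2 h).
Proof.
have m1 : measurable_fun setT (fun tz : state R d * 'rV[R]_d => tz.1.1).
  exact: (measurableT_comp measurable_fst measurable_fst).
have m2 : measurable_fun setT (fun tz : state R d * 'rV[R]_d => tz.1.2).
  exact: (measurableT_comp measurable_snd measurable_fst).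
under eq_fun do rewrite ES_stepE.
apply: measurable_fun_ifT.
- apply: measurable_fun_ler; first exact: measurableT_comp measurable_trial.
  exact: measurableT_comp m1.
- by apply: measurable_fun_pair; [exact: measurable_trial|exact: measurable_funD].
- by apply: measurable_fun_pair; [exact: m1|exact: measurable_funD].
Qed.

(** The measurable structure on the sample space is arbitrary so that it can be
instantiated with the sigma-algebra of the past, which is how adaptedness is
obtained. *)
Lemma measurable_ES (dd : measure_display) (S : measurableType dd)
    (theta0 : state R d) (z : nat -> S -> 'rV[R]_d) t :
  (forall s, (s < t)%N -> measurable_fun setT (z s)) ->
  measurable_fun setT (fun w => ES au ad h theta0 (fun s => z s w) t).
Proof.
elim: t => [|t ih] mz /=; first exact: measurable_cst.
apply: (measurableT_comp measurable_ES_step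
  (g := fun w => (ES au ad h theta0 (fun s => z s w) t, z t w))).
apply: measurable_fun_pair; last exact: mz.
by apply: ih => s st; apply: mz; rewrite ltnS ltnW.
Qed.

End ES_measurability.

Section ES_process.
Context {R : realType} {d : nat} (au ad : R) (h : 'rV[R]_d -> R).
Hypothesis mh : measurable_fun setT h.
Context {disp : measure_display} {T : measurableType disp} (P : probability T R)
  (z : nat -> {RV P >-> 'rV[R]_d}).
Hypothesis hz_law : forall t, has_law (z t) (std_normal d).
Hypothesis hz_indep : mutually_independent z.
Variables (theta0 : state R d) (x : 'rV[R]_d).

Let Theta t w := ES au ad h theta0 (fun s => z s w) t.

Lemma measurable_ES_state t : measurable_fun setT (Theta t).
Proof. by apply: measurable_ES => // s _; exact: measurable_funPT. Qed.

Lemma ES_state_past t A : measurable A -> <<s past z t>> (Theta t @^-1` A).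
Proof.
move=> mA.
have past_mono s : (s < t)%N -> past z s.+1 `<=` past z t.
  elim: t {mA} => // k ih; rewrite ltnS leq_eqVlt => /predU1P[->//|/ih sk].
  exact: (subset_trans sk (@past_subS _ _ _ _ _ _ _ _)).
have : measurable_fun (T := g_sigma_algebraType (past z t)) setT (Theta t).
  apply: measurable_ES => // s st _ B mB; rewrite setTI.
  by apply: sub_sigma_algebra; apply: (past_mono s st); exact: past_last.
by move=> /(_ measurableT A mA); rewrite setTI.
Qed.

Lemma ES_state_indep t A B : measurable A -> measurable B ->
  P (Theta t @^-1` A `&` z t @^-1` B) = (P (Theta t @^-1` A) * P (z t @^-1` B))%E.
Proof. by move=> mA mB; apply: past_indep => //; exact: ES_state_past. Qed.

Lemma measurable_potential_mean p t :
  measurable_fun setT (fun w => potential p (mean (Theta t w) - x)).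
Proof.
apply: (measurableT_comp (measurable_potential p (d:=d))
  (g := fun w => mean (Theta t w) - x)).
apply: measurable_rVD => //.
exact: (measurableT_comp measurable_fst (measurable_ES_state t)).
Qed.

Lemma expected_potential_step n t : (n.+2.*2 <= d)%N ->
  (\int[P]_w potential (n.+1%:R / 5) (mean (Theta t.+1 w) - x) <=
   (1 + tangent_slope)%:E * \int[P]_w potential (n.+1%:R / 5) (mean (Theta t w) - x))%E.
Proof.
move=> nd; set p := n.+1%:R / 5.
pose g (tz : state R d * 'rV[R]_d) : \bar R :=
  maxe (potential p (tz.1.1 - x)) (potential p (tz.1.1 - x + expR tz.1.2 *: tz.2)).
have mp := measurable_potential p (d:=d).
have mv : measurable_fun setT (fun tz : state R d * 'rV[R]_d => tz.1.1 - x).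
  apply: measurable_rVD => //.
  exact: (measurableT_comp measurable_fst measurable_fst).
have mw : measurable_fun setT
    (fun tz : state R d * 'rV[R]_d => tz.1.1 - x + expR tz.1.2 *: tz.2).
  under eq_fun do rewrite addrAC.
  by apply: measurable_rVD => //; exact: measurable_trial.
have mg : measurable_fun setT g.
  by apply: measurable_maxe; [exact: measurableT_comp mp mv|exact: measurableT_comp mp mw].
have g0 tz : (0 <= g tz)%E by rewrite /g le_max potential_ge0.
pose X : {RV P >-> state R d} :=
  HB.pack (Theta t) (isMeasurableFun.Build _ _ _ _ (Theta t) (measurable_ES_state t)).
have mX : measurable_fun setT X by exact: measurable_funPT.
apply: (@le_trans _ _ (\int[P]_w g (X w, z t w))%E).
  apply: ge0_le_integral => //.
  - by move=> w _; exact: potential_ge0.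
  - exact: measurable_potential_mean.
  - by apply: (measurableT_comp mg); apply: measurable_fun_pair.
  - by move=> w _; exact: potential_ES_step.
rewrite ge0_integral_indep_pair//; last exact: ES_state_indep.
rewrite -ge0_integralZl//; last 3 first.
- exact: measurable_potential_mean.
- by move=> w _; exact: potential_ge0.
- by rewrite lee_fin addr_ge0// ltW// tangent_slope_gt0.
apply: ge0_le_integral => //.
- by move=> w _; exact: integral_ge0.
- apply: (measurableT_comp (measurable_fun_fubini_tonelli_F
    (m2 := distribution P (z t)) g mg g0)) => //.
- by apply: measurable_funeM; exact: measurable_potential_mean.
- move=> w _.
  rewrite (eq_measure_integral (std_normal d)); last by move=> A mA _; exact: hz_law.
  have := @expected_max_potential_le R n d ((Theta t w).1 - x) _ nd (expR_gt0 (Theta t w).2).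
  by rewrite -/p; exact.
Qed.

Lemma expected_potential_le n t : (n.+2.*2 <= d)%N ->
  (\int[P]_w potential (n.+1%:R / 5) (mean (Theta t w) - x) <=
   ((1 + tangent_slope) ^+ t)%:E * potential (n.+1%:R / 5) (mean theta0 - x))%E.
Proof.
move=> nd; elim: t => [|t ih].
  apply: (@le_trans _ _ (\int[P]_w cst (potential (n.+1%:R / 5) (mean theta0 - x)) w)%E) => //.
  by rewrite integral_cst// [X in (_ * X)%E]probability_setT mule1 expr0 mul1e.
apply: (le_trans (expected_potential_step t nd)).
by rewrite exprS EFinM -muleA lee_wpmul2l// lee_fin addr_ge0// ltW// tangent_slope_gt0.
Qed.

End ES_process.

(** * The convergence rate *)

Section rate.
Context {R : realType}.

(** The margin is small (1.08192 against 1.08329), so 1 + x <= exp x has to be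
applied at a third of the exponent. *)
Lemma tangent_slope_lt_expR : 1 + tangent_slope < expR (2 / 25) :> R.
Proof.
have -> : 2 / 25 = 2 / 75 * 3%:R :> R by field.
rewrite expRM_natr; apply: (@lt_le_trans _ _ ((1 + 2 / 75) ^+ 3)); last first.
  by rewrite lerXn2r ?expR_ge1Dx// nnegrE ?expR_ge0// addr_ge0// divr_ge0.
rewrite /tangent_slope; lra.
Qed.

Lemma enorm_gt0 d (y : 'rV[R]_d) : y != 0 -> 0 < enorm y.
Proof. by move=> y0; rewrite /enorm sqrtr_gt0 dot_gt0. Qed.

Lemma ln_enorm d (y : 'rV[R]_d) : ln (enorm y) = ln (dot y y) / 2.
Proof. by rewrite /enorm -powR12_sqrt ?dot_ge0// ln_powR mulrC. Qed.

(** Taking logarithms of |y_t|^(-2p) <= K exp(2 p a t), where y_t is the distance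
vector, gives log |y_t| >= - a t - log K / (2p). The remaining term in the
constant comes from normalising by the initial distance. *)
Lemma log_rate_ge d (theta : nat -> state R d) (x : 'rV[R]_d) (p a K : R) t :
  0 < p -> (0 < t)%N -> mean (theta 0%N) != x ->
  ((expR (- (2 * p * a)) ^+ t)%:E * potential p (mean (theta t) - x) <= K%:E)%E ->
  ((- a - `|ln K / (2 * p) + ln (dot (mean (theta 0%N) - x) (mean (theta 0%N) - x)) / 2|
     / t%:R)%:E <= log_rate theta x t)%E.
Proof.
move=> p0 t0; rewrite -subr_eq0 /log_rate.
set y0 := mean (theta 0%N) - x; set y := mean (theta t) - x => y00.
have [->|yn0] := eqVneq y 0.
  by rewrite potential0 gt0_muley ?lte_fin ?exprn_gt0 ?expR_gt0.
rewrite potentialE// -EFinM lee_fin => hK.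
have q0 := dot_gt0 yn0.
have l0 : 0 < expR (- (2 * p * a)) ^+ t * dot y y `^ (- p).
  by rewrite mulr_gt0 ?exprn_gt0 ?expR_gt0 ?powR_gt0.
have K0 : 0 < K := lt_le_trans l0 hK.
move: hK; rewrite -ler_ln ?posrE// lnM ?posrE ?exprn_gt0 ?expR_gt0 ?powR_gt0//.
rewrite -expRM_natr expRK ln_powR => hK.
have d0 := enorm_gt0 y00; have d1 := enorm_gt0 yn0.
rewrite lne_EFin ?divr_gt0// ln_div ?posrE// !ln_enorm -EFinM lee_fin.
have tR : 0 < t%:R :> R by rewrite ltr0n.
rewrite ler_pdivlMl// mulrBr mulrCA divff ?gt_eqF// mulr1.
set C := _ / (2 * p) + _.
have hC : - `|C| <= - C by rewrite lerN2 ler_norm.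
have : - a * t%:R - ln K / (2 * p) <= ln (dot y y) / 2.
  rewrite -(ler_pM2r (_ : 0 < 2 * p)) ?mulr_gt0//.
  have -> : (- a * t%:R - ln K / (2 * p)) * (2 * p) = - (2 * p * a) * t%:R - ln K.
    by field; rewrite gt_eqF.
  have -> : ln (dot y y) / 2 * (2 * p) = - (- p * ln (dot y y)) by field.
  by rewrite lerBlDr addrC -lerBlDr opprK.
move: hC; rewrite /C; lra.
Qed.

Lemma measurable_lne_EFin : measurable_fun setT (fun r : R => lne r%:E).
Proof.
apply: measurable_fun_ifT; first exact: measurable_fun_ler.
- exact: measurable_cst.
- by apply/measurable_EFinP; exact: measurable_ln.
Qed.

Lemma measurable_enorm d : measurable_fun setT (@enorm R d).
Proof.
rewrite (_ : @enorm R d = (fun r => r `^ 2^-1) \o (fun y => dot y y)).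
  by apply: measurableT_comp; [exact: measurable_powR|exact: measurable_dot].
by apply/funext => y; rewrite /= powR12_sqrt ?dot_ge0.
Qed.

Lemma measurable_liminf_log_rate d (disp : measure_display) (T : measurableType disp)
    (theta : nat -> T -> state R d) (x : 'rV[R]_d) :
  (forall t, measurable_fun setT (theta t)) ->
  measurable_fun setT (fun w => limn_einf (log_rate (theta ^~ w) x)).
Proof.
move=> mtheta.
have mn t : measurable_fun setT (fun w => enorm (mean (theta t w) - x)).
  apply: (measurableT_comp (@measurable_enorm d) (g := fun w => mean (theta t w) - x)).
  apply: measurable_rVD => //.
  exact: (measurableT_comp measurable_fst (mtheta t)).
apply: (measurableT_comp (f := -%E)) => //.
apply: measurable_fun_limn_esup => t.
apply: (measurableT_comp (f := -%E)) => //.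
apply: measurable_funeM.
apply: (measurableT_comp measurable_lne_EFin
  (g := fun w => enorm (mean (theta t w) - x) / enorm (mean (theta 0%N w) - x))).
apply: measurable_funM => //.
rewrite (_ : (fun w => _) = (fun r => r `^ (-1)) \o (fun w => enorm (mean (theta 0%N w) - x))).
  by apply: measurableT_comp => //; exact: measurable_powR.
by apply/funext => w; rewrite /= powR_inv1// sqrtr_ge0.
Qed.
End rate.

(** A lower convergence rate is the almost sure value of the same limit inferior,
so the second part holds because two almost sure events cannot be disjoint. *)
Theorem theorem16 (R : realType) (d : nat) (L U gamma alpha_up alpha_down : R)
    (hd : (3 < d)%N) (hL : 0 < L) (hLU : L <= U)
    (hup : 1 < alpha_up) (hdown0 : 0 < alpha_down) (hdown1 : alpha_down < 1)
    (disp : measure_display) (T : measurableType disp) (P : probability T R)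
    (z : nat -> {RV P >-> 'rV[R]_d})
    (hz_law : forall t, has_law (z t) (std_normal d))
    (hz_indep : mutually_independent z)
    (h : 'rV[R]_d -> R) (hP : Pclass gamma L U h)
    (xopt : 'rV[R]_d) (hxopt : unique_global_min h xopt)
    (theta0 : state R d) (hm0 : mean theta0 != xopt)
    (theta : nat -> T -> state R d)
    (htheta : forall t w,
       theta t w = ES alpha_up alpha_down h theta0 (fun s => z s w) t) :
  P [set w | ((- d%:R^-1)%:E <= limn_einf (log_rate (theta ^~ w) xopt))%E] = 1%E
  /\
  forall CR : \bar R, is_CR_lower P theta xopt CR ->
    (expeR (- d%:R^-1)%:E <= expeR (- CR))%E.
Proof.
have mh : measurable_fun setT h by case: hP => f _ [].
have thetaE : theta = fun t w => ES alpha_up alpha_down h theta0 (fun s => z s w) t.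
  by apply/funext => t; apply/funext => w.
have mtheta t : measurable_fun setT (theta t).
  by rewrite thetaE; exact: measurable_ES_state.
pose LI w := limn_einf (log_rate (theta ^~ w) xopt).
have mLI : measurable_fun setT LI by exact: measurable_liminf_log_rate.
set E := [set w | _].
have mE : measurable E.
  by rewrite -[E]setTI; exact: emeasurable_fun_c_infty.
have PE1 : P E = 1%E.
  (* The exponent k of the Riesz kernel is n + 1 = d/2 - 1, and p = k / 5. *)
  pose n := (d./2 - 2)%N; pose p : R := n.+1%:R / 5.
  have nd : (n.+2.*2 <= d)%N by rewrite /n; lia.
  have nd5 : (d <= 5 * n.+1)%N by rewrite /n; lia.
  have d0 : 0 < d%:R :> R by rewrite ltr0n; lia.
  have p0 : 0 < p by rewrite divr_gt0.
  have m0x : mean theta0 - xopt != 0 by rewrite subr_eq0.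
  pose k := expR (- (2 * p * d%:R^-1)).
  have k0 : 0 < k by exact: expR_gt0.
  have kslope : k * (1 + tangent_slope) < 1.
    rewrite /k expRN mulrC ltr_pdivrMr ?expR_gt0// mul1r.
    apply: (lt_le_trans tangent_slope_lt_expR); rewrite ler_expR.
    rewrite ler_pdivlMr// /p mulrAC ler_pdivrMr//.
    have : d%:R <= 5 * n.+1%:R :> R by rewrite -natrM ler_nat.
    by lra.
  pose V t w := ((k ^+ t)%:E * potential p (mean (theta t w) - xopt))%E.
  have mpot t : measurable_fun setT (fun w => potential p (mean (theta t w) - xopt)).
    by rewrite thetaE; exact: measurable_potential_mean.
  pose v0 := dot (mean theta0 - xopt) (mean theta0 - xopt) `^ (- p).
  have /(ae_bounded_of_geometric_integrals (P := P) (V := V) (C := v0)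
      (r := k * (1 + tangent_slope))) :
      forall t, measurable_fun setT (V t).
    by move=> t; exact: measurable_funeM.
  have k1 : 0 < 1 + tangent_slope :> R by rewrite addr_gt0// tangent_slope_gt0.
  move=> /(_ _ (powR_ge0 _ _) (ltW (mulr_gt0 k0 k1)) kslope) bounded.
  have /bounded {}bounded : forall t w, (0 <= V t w)%E.
    by move=> t w; rewrite mule_ge0 ?potential_ge0// lee_fin exprn_ge0// ltW.
  have /bounded {}bounded : forall t, (\int[P]_w V t w <= (v0 * (k * (1 + tangent_slope)) ^+ t)%:E)%E.
    move=> t; rewrite ge0_integralZl//; last 2 first.
    - by move=> w _; exact: potential_ge0.
    - by rewrite lee_fin exprn_ge0// ltW.
    rewrite exprMn mulrC -mulrA EFinM lee_wpmul2l ?lee_fin ?exprn_ge0 ?(ltW k0)//.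
    rewrite EFinM -potentialE// thetaE.
    exact: expected_potential_le.
  have aeE : {ae P, forall w, E w}.
    apply: filterS bounded => w [K hK].
    apply: (limn_einf_ge_affine (C := `|ln K / (2 * p) +
      ln (dot (mean theta0 - xopt) (mean theta0 - xopt)) / 2|)) => // t t0.
    have := @log_rate_ge R d (theta ^~ w) xopt p d%:R^-1 K t p0 t0.
    by rewrite [theta 0%N w]htheta; apply => //; exact: hK.
  have PC0 : P (~` E) = 0%E by apply/negligibleP => //; exact: measurableC.
  by have := probability_setC P (measurableC mE); rewrite setCK PC0 sube0.
split=> // CR hCR; rewrite lee_expeR leNgt; apply/negP => CRlt.
have : (P [set w | LI w = (- CR)%E] <= P (~` E))%E.
  apply: le_measure; rewrite ?inE.
  - rewrite (_ : [set w | _] = LI @^-1` [set (- CR)%E])//.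
    by rewrite -[X in measurable X]setTI; apply: mLI => //; exact: emeasurable_set1.
  - exact: measurableC.
  - move=> w /= LIw; rewrite /E/= -/(LI w) LIw.
    by apply/negP; rewrite -ltNge.
by rewrite hCR (probability_setC P mE) PE1 subee// lee_fin ler10.
Qed.
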